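(* Let $G$ be a connected simple graph with $\chi(G)=3$ whose vertex set is partitioned into three independent sets $V_1=\{w\}$, $V_2=\{u_1,\ldots,u_x\}$ with $x\ge 2$, and $V_3=\{v_1,\ldots,v_y\}$ with $y\ge 2$, such that $w$ is adjacent to exactly $2a+1$ vertices of $V_2$ and exactly $2b+1$ vertices of $V_3$ for some integers $a,b\ge 0$, every vertex of $V_2$ has degree $2m$, and every vertex of $V_3$ has degree $2n$ (for some positive integers $m,n$). Then $\chi_{la}(G)=3$.
   Context: For a graph $G=(V,E)$ with $q$ edges, a bijection $f:E\to\{1,\ldots,q\}$ is a local antimagic labeling if $f^+(u)\ne f^+(v)$ for all adjacent $u,v$, where $f^+(u)$ is the sum of labels of edges incident to $u$. $\chi_{la}(G)$ is the minimum number of distinct values of $f^+$ over all local antimagic labelings of $G$; $\chi(G)$ is the chromatic number. *)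

(* Defs.v *)
From mathcomp Require Import all_boot.

Set Implicit Arguments.
Unset Strict Implicit.
Unset Printing Implicit Defensive.

(* A finite simple graph on the vertex type T is given by its adjacency
   relation e : rel T, assumed symmetric and irreflexive. *)

Definition is_minimum (P : nat -> Prop) (k : nat) : Prop :=
  P k /\ forall j, P j -> k <= j.

Section Graph.
Variables (T : finType) (e : rel T).

Definition connected_graph : Prop := forall u v, connect e u v.

Definition independent (A : {set T}) : Prop :=
  {in A &, forall u v, ~~ e u v}.

Definition neighbors (u : T) : {set T} := [set v | e u v].

Definition degree (u : T) : nat := #|neighbors u|.

Definition colorable (k : nat) : Prop :=
  exists c : T -> 'I_k, forall u v, e u v -> c u != c v.

Definition is_chromatic_number : nat -> Prop := is_minimum colorable.

Definition edges : {set {set T}} :=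
  [set [set p.1; p.2] | p : T * T & e p.1 p.2].

(* A labeling is a function on all vertex sets; only its values on edges
   matter. *)
Definition edge_labeling (f : {set T} -> nat) : Prop :=
  [/\ {in edges, forall d, 1 <= f d <= #|edges|},
      {in edges &, injective f}
    & forall k, 1 <= k <= #|edges| -> exists2 d, d \in edges & f d = k].

Definition vertex_sum (f : {set T} -> nat) (u : T) : nat :=
  \sum_(d in edges | u \in d) f d.

Definition local_antimagic (f : {set T} -> nat) : Prop :=
  edge_labeling f /\ forall u v, e u v -> vertex_sum f u <> vertex_sum f v.

Definition num_vertex_sums (f : {set T} -> nat) : nat :=
  size (undup [seq vertex_sum f u | u : T]).

(* Stated as a relation because a graph such as K_2 has no local antimagic
   labeling; is_local_antimagic_chromatic_number k also asserts that k is
   attained. *)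
Definition is_local_antimagic_chromatic_number : nat -> Prop :=
  is_minimum (fun k => exists2 f, local_antimagic f & num_vertex_sums f = k).

End Graph.

(* Main.v *)
(* Split [w] into one vertex keeping its edges to V2 and one keeping its edges
   to V3.  The result is bipartite, and these two vertices are its only ones of
   odd degree, so it has an Euler trail from the first to the second.  Label
   the edges along the trail by 1, q, 2, q-1, ...: consecutive labels add up
   alternately to q+1 and q+2, hence every passage through V2 contributes q+1
   and every passage through V3 contributes q+2.  The sums on V2, on V3 and at
   [w] are thus three constants, which a size estimate shows to be distinct.
   Conversely, the vertex sums of a local antimagic labeling are a proper
   colouring. *)
Require Import Defs.
From mathcomp Require Import all_boot zify.

Set Implicit Arguments.
Unset Strict Implicit.
Unset Printing Implicit Defensive.

(** * Euler trails *)

(* A multigraph is encoded by its darts (oriented edges): [rev] reverses a dart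
   and the vertices are the values of [src]. *)
Section EulerTrail.
Variables (D : finType) (V : eqType) (rev : D -> D) (src : D -> V).
Hypothesis revK : involutive rev.

Definition tgt d := src (rev d).

Fixpoint walk x c y :=
  if c is d :: c' then (src d == x) && walk (tgt d) c' y else x == y.

Definition visited x c := x :: map tgt c.

(** Both orientations of every edge walked, so that [uniq (traversed c)] forbids using an edge
    twice, in either direction. *)
Definition traversed c := c ++ map rev c.

Definition trail (F : {set D}) c :=
  uniq (traversed c) && all [in F] (traversed c).

Definition dart_degree (F : {set D}) z := #|[set d in F | src d == z]|.

Lemma walk_cat x y z c1 c2 :
  walk x c1 y -> walk x (c1 ++ c2) z = walk y c2 z.
Proof.
elim: c1 x => [|d c IH] x /=; first by move/eqP->.
by case/andP=> -> /IH.
Qed.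

Lemma walk_split x y v c : walk x c y -> v \in visited x c ->
  exists c1 c2, [/\ c = c1 ++ c2, walk x c1 v & walk v c2 y].
Proof.
elim: c x => [|d c IH] x /=.
  by move=> Exy; rewrite inE => /eqP->; exists [::], [::]; split=> /=.
case/andP=> dx Hc; rewrite inE => /orP[/eqP->|vc].
  by exists [::], (d :: c); split=> //=; rewrite ?dx.
have [c1 [c2 [-> w1 w2]]] := IH _ Hc vc.
by exists (d :: c1), c2; split=> //=; rewrite dx.
Qed.

Lemma walk_end_visited x y c : walk x c y -> y \in visited x c.
Proof.
elim: c x => [|d c IH] x /=; first by move/eqP->; rewrite mem_head.
by case/andP=> _ /IH yc; rewrite inE yc orbT.
Qed.

Lemma mem_traversed d c : (d \in traversed c) = (d \in c) || (rev d \in c).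
Proof.
rewrite mem_cat; congr (_ || _).
by rewrite -{1}[d]revK mem_map //; apply: inv_inj.
Qed.

Lemma traversed_rev d c : (rev d \in traversed c) = (d \in traversed c).
Proof. by rewrite !mem_traversed revK orbC. Qed.

Lemma traversed_cat c1 c2 :
  perm_eq (traversed (c1 ++ c2)) (traversed c1 ++ traversed c2).
Proof.
rewrite /traversed map_cat -!catA perm_cat2l !catA perm_cat2r.
by rewrite perm_catC.
Qed.

Lemma src_traversed x y c d :
  walk x c y -> d \in traversed c -> src d \in visited x c.
Proof.
move=> W; rewrite mem_traversed => /orP[]; last first.
  by move=> /(map_f tgt); rewrite /tgt revK inE => ->; rewrite orbT.
elim: c x W => [//|d' c IH] x /= /andP[/eqP Ex W].
rewrite inE => /orP[/eqP->|/(IH _ W) H]; first by rewrite Ex mem_head.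
by rewrite inE H orbT.
Qed.

(** Departures from [z] and arrivals at [z] balance, except at the two ends of the walk; the
    additive form avoids truncated subtraction. *)
Lemma count_src_walk x y c z : walk x c y ->
  count (fun d => src d == z) c + (y == z)
  = count (fun d => tgt d == z) c + (x == z).
Proof.
elim: c x => [|d c IH] x /=; first by move/eqP->.
by case/andP=> /eqP<- /IH; lia.
Qed.

Lemma count_src_traversed c z :
  count (fun d => src d == z) (traversed c)
  = count (fun d => src d == z) c + count (fun d => tgt d == z) c.
Proof. by rewrite count_cat count_map. Qed.

(** Each visit uses one arriving and one departing dart, but the first visit lacks an arrival and
    the last a departure. This turns parities of degrees into statements about the ends of a
    trail. *)
Lemma count_visited x y c z : walk x c y ->
  (count_mem z (visited x c)).*2
  = count (fun d => src d == z) (traversed c) + (x == z) + (y == z).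
Proof.
move=> W; have := count_src_walk z W; rewrite count_src_traversed /=.
rewrite count_map (@eq_count _ (preim _ _) (fun d => tgt d == z)) //; lia.
Qed.

Lemma count_dart_degree (F : {set D}) c z : uniq c -> c =i F ->
  count (fun d => src d == z) c = dart_degree F z.
Proof.
move=> Uc cF; rewrite -size_filter -(card_uniqP (filter_uniq _ Uc)).
by apply: eq_card => d; rewrite mem_filter !inE cF andbC.
Qed.

Lemma dart_degreeD (F : {set D}) c z : trail F c ->
  dart_degree (F :\: [set d in traversed c]) z
  = dart_degree F z - count (fun d => src d == z) (traversed c).
Proof.
case/andP=> U /allP cF.
rewrite (count_dart_degree (F := [set d in traversed c])) //; last first.
  by move=> d; rewrite inE.
rewrite /dart_degree -cardsDS; last first.
  by apply/subsetP=> d; rewrite !inE => /andP[/cF dF ->]; rewrite andbT.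
by apply: eq_card => d; rewrite !inE; case: (src d == z); rewrite ?andbF ?andbT.
Qed.

Lemma trail_dart_degree (F : {set D}) c z : trail F c ->
  count (fun d => src d == z) (traversed c) <= dart_degree F z.
Proof.
case/andP=> U /allP cF.
rewrite (count_dart_degree (F := [set d in traversed c])) //; last first.
  by move=> d; rewrite inE.
by apply/subset_leq_card/subsetP=> d; rewrite !inE => /andP[/cF dF ->]; rewrite andbT.
Qed.

Lemma trail_cat (F : {set D}) c1 c2 :
  trail F c1 -> trail (F :\: [set d in traversed c1]) c2 -> trail F (c1 ++ c2).
Proof.
case/andP=> U1 A1 /andP[U2 /allP A2]; rewrite /trail.
rewrite (perm_uniq (traversed_cat c1 c2)) (perm_all _ (traversed_cat c1 c2)).
rewrite cat_uniq all_cat U1 U2 A1 andbT /=; apply/andP; split.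
  by apply/hasPn => d /A2; rewrite !inE => /andP[].
by apply/allP => d /A2; rewrite !inE => /andP[].
Qed.

(** Being a trail depends only on the multiset of darts. This lets a detour [c2], known to be
    appendable, be spliced into the middle. *)
Lemma trail_catCA (F : {set D}) c1 c2 c3 :
  trail F (c1 ++ c2 ++ c3) = trail F ((c1 ++ c3) ++ c2).
Proof.
have P : perm_eq (traversed (c1 ++ c2 ++ c3)) (traversed ((c1 ++ c3) ++ c2)).
  have Q : perm_eq (c1 ++ c2 ++ c3) ((c1 ++ c3) ++ c2).
    by rewrite -catA perm_cat2l perm_catC.
  by apply: perm_cat => //; apply: perm_map.
by rewrite /trail (perm_uniq P) (perm_all _ P).
Qed.

Variable F : {set D}.
Hypothesis rev_mem : {in F, forall d, rev d \in F}.
Hypothesis rev_neq : {in F, forall d, rev d != d}.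

Lemma setD_traversed_rev c :
  {in F :\: [set d in traversed c],
     forall d, rev d \in F :\: [set d in traversed c]}.
Proof.
move=> d; by rewrite !inE traversed_rev => /andP[-> /rev_mem].
Qed.

Lemma trail1 d : d \in F -> trail F [:: d].
Proof.
move=> dF; rewrite /trail /= !inE dF rev_mem // !andbT eq_sym.
exact: rev_neq.
Qed.

Lemma trail_size c : trail F c -> (size c).*2 <= #|F|.
Proof.
case/andP=> U /allP cF.
rewrite -addnn -[X in _ + X](size_map rev) -size_cat -(card_uniqP U).
by apply/subset_leq_card/subsetP.
Qed.
End EulerTrail.

(** * Existence of Euler trails, and weights summed along a walk *)

Section Euler.
Variables (D : finType) (V : eqType) (rev : D -> D) (src : D -> V).
Hypothesis revK : involutive rev.
Notation tgt := (tgt rev src).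
Notation walk := (walk rev src).
Notation trail := (trail rev).
Notation traversed := (traversed rev).

(* A trail that stops short of [t] leaves an odd number of unused darts at its
   end, so it can be prolonged. *)
Lemma extend_trail (F : {set D}) (s t y : V) c :
  {in F, forall d, rev d \in F} -> {in F, forall d, rev d != d} ->
  (forall z, odd (dart_degree src F z) = (z == s) (+) (z == t)) ->
  walk s c y -> trail F c ->
  exists2 c', walk s (c ++ c') t & trail F (c ++ c').
Proof.
move=> Frev Fneq Fodd.
have [k] := ubnP (#|F| - size c); elim: k c y => // k IH c y lek W Tc.
have [Ey|ney] := eqVneq y t.
  by exists [::]; rewrite cats0 // -Ey.
have dv := dart_degreeD src y Tc; have led := trail_dart_degree src y Tc.
have := count_visited y W; have := count_src_traversed rev src c y.
rewrite eqxx => Ecnt Evis.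
have: odd (dart_degree src (F :\: [set d in traversed c]) y).
  rewrite dv oddB // Fodd (negbTE ney).
  have := congr1 odd Evis; rewrite odd_double !oddD !oddb.
  by rewrite (eq_sym s); case: (y == s); case: (odd _).
case: (set_0Vmem [set d in F :\: [set d in traversed c] | src d == y]).
  by rewrite /dart_degree => ->; rewrite cards0.
case=> d; rewrite inE => /andP[dF' /eqP dy] _.
have Td : trail (F :\: [set d in traversed c]) [:: d].
  apply: trail1 => //; first exact: setD_traversed_rev.
  by move=> d'; rewrite inE => /andP[_ /Fneq].
have Tcd := trail_cat Tc Td.
have Wcd : walk s (c ++ [:: d]) (tgt d).
  by rewrite (walk_cat _ _ W) /= dy !eqxx.
have [|c' W' T'] := IH _ _ _ Wcd Tcd.
  by have := trail_size Tcd; rewrite size_cat /=; lia.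
by exists (d :: c'); rewrite -cat1s catA.
Qed.

(* The last hypothesis says that every component contains [s] or [t]. *)
Theorem Euler_trail (F : {set D}) (s t : V) :
  {in F, forall d, rev d \in F} -> {in F, forall d, rev d != d} ->
  (forall z, odd (dart_degree src F z) = (z == s) (+) (z == t)) ->
  (forall A : {set D}, A \subset F ->
     {in A, forall d, rev d \in A} ->
     {in A & F, forall d d', src d = src d' -> d' \in A} ->
     {in F, forall d, (src d == s) || (src d == t) -> d \in A} ->
     A = F) ->
  exists c, [/\ walk s c t, uniq (traversed c) & traversed c =i F].
Proof.
move=> Frev Fneq Fodd Fconn.
have [c] : exists2 c, walk s c t & trail F c.
  by apply: (extend_trail Frev Fneq Fodd (c := [::]) (y := s)) => /=.
have [k] := ubnP (#|F| - size c); elim: k c => // k IH c lek W Tc.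
have [U /allP cF] := andP Tc.
case: (pickP [pred d in F | (d \notin traversed c)
                            && (src d \in visited rev src s c)]) => [d|noext].
  case/and3P=> dF dc vd.
  pose F' := F :\: [set d in traversed c].
  have F'rev : {in F', forall d, rev d \in F'} by apply: setD_traversed_rev.
  have F'neq : {in F', forall d, rev d != d}.
    by move=> d'; rewrite inE => /andP[_ /Fneq].
  have dF' : d \in F' by rewrite !inE dc.
  have F'even z : odd (dart_degree src F' z) = (z == src d) (+) (z == src d).
    rewrite addbb dart_degreeD // oddB ?trail_dart_degree // Fodd.
    have := congr1 odd (count_visited z W).
    rewrite odd_double !oddD !oddb (eq_sym s) (eq_sym t).
    by case: (z == s); case: (z == t); case: (odd _).
  have Wd : walk (src d) [:: d] (tgt d) by rewrite /= !eqxx.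
  (* Starting from [[:: d]] rather than from the empty trail makes the closed detour nonempty. *)
  have [c' W' T'] := extend_trail F'rev F'neq F'even Wd (trail1 F'rev F'neq dF').
  have [c1 [c2 [Ec W1 W2]]] := walk_split W vd.
  apply: (IH (c1 ++ ([:: d] ++ c') ++ c2)).
  - have T3 : trail F (c ++ [:: d] ++ c') by apply: trail_cat.
    have := trail_size T3; move: lek; rewrite Ec !size_cat /=.
    by move: (size c1) (size c2) (size c') #|F| => s1 s2 s' N; clear; lia.
  - by rewrite (walk_cat _ _ W1) (walk_cat _ _ W').
  - by rewrite trail_catCA -Ec; apply: trail_cat.
exists c; split=> //.
(* With no dart left to add, the traversed darts form a set to which the connectivity hypothesis
   applies. *)
have ext d : d \in F -> src d \in visited rev src s c -> d \in traversed c.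
  by move=> dF vd; have /= := noext d; rewrite dF vd andbT; case: (d \in _).
have visE := walk_end_visited W.
have <- : [set d in traversed c] = F; last by move=> d; rewrite inE.
apply: Fconn => [|d|d d'|d dF].
- by apply/subsetP=> d; rewrite inE => /cF.
- by rewrite !inE traversed_rev.
- rewrite !inE => dc d'F Ed; apply: ext => //.
  by rewrite -Ed (src_traversed revK W).
- by rewrite inE => /orP[] /eqP Ed; apply: ext; rewrite // Ed // mem_head.
Qed.

(* The [i]-th dart carries the weight [h i.+1]; [h 0] and [h (size c).+1] are
   the weights of two fictitious darts entering the walk at [x] and leaving it
   at [y], so that each visit pairs two consecutive weights. *)
Lemma sum_walk_weight d0 (K : nat) (h : nat -> nat) x y c z :
  walk x c y ->
  (forall i, i <= size c -> nth x (visited rev src x c) i = z ->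
     h i + h i.+1 = K) ->
  \sum_(i < size c)
     h i.+1 * ((src (nth d0 c i) == z) + (tgt (nth d0 c i) == z))
  + (x == z) * h 0 + (y == z) * h (size c).+1
  = K * count_mem z (visited rev src x c).
Proof.
elim: c h x => [|d c IH] h x /=.
  move/eqP<- => H; rewrite big_ord0; case: eqP => Ex; last by rewrite muln0.
  by have := H 0 isT Ex; lia.
case/andP=> /eqP Ex W H.
rewrite big_ord_recl /=.
(* For the tail of the walk, [d] itself plays the fictitious entering dart, hence the shifted
   weights. *)
have {IH} := IH (fun i => h i.+1) _ W; rewrite /= => IH.
rewrite [RHS]mulnDr -IH; last first.
  move=> i lei Ei; apply: (H i.+1) => //; rewrite -Ei /=.
  by apply: set_nth_default; rewrite /= size_map ltnS.
rewrite Ex; set S := (X in _ + X + _ + _).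
rewrite -[X in _ = _ + (X + _ + _)]/S.
case: (eqVneq x z) => [Exz|_]; last lia.
by have := H 0 isT Exz; lia.
Qed.

End Euler.

(** * Labels along the trail *)

Section GraphFacts.
Variables (T : finType) (e : rel T).
Hypothesis e_irr : irreflexive e.

(** The colour of a vertex is the index of its sum in the list of distinct sums. *)
Lemma num_vertex_sums_colorable f :
  local_antimagic e f -> colorable e (num_vertex_sums e f).
Proof.
case=> _ neq_f; pose s := undup [seq vertex_sum e f u | u : T].
have fs u : vertex_sum e f u \in s by rewrite mem_undup map_f ?mem_enum.
have ltfs u : index (vertex_sum e f u) s < size s by rewrite index_mem.
exists (fun u => Ordinal (ltfs u)) => u v /neq_f neq_uv.
by apply/eqP => -[] /(congr1 (nth 0 s)); rewrite !nth_index // => /neq_uv.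
Qed.

Lemma pair_neighbor_inj (u v v' : T) :
  e u v -> [set u; v] = [set u; v'] -> v = v'.
Proof.
move=> euv E; have : v \in [set u; v'] by rewrite -E set22.
by rewrite !inE => /orP[/eqP Ev|/eqP //]; rewrite Ev e_irr in euv.
Qed.

Lemma degree_le_edges u : degree e u <= #|edges e|.
Proof.
rewrite /degree -(@card_in_imset _ _ (fun v => [set u; v])); last first.
  by move=> v v'; rewrite inE => euv _; apply: pair_neighbor_inj.
apply/subset_leq_card; apply/subsetP=> d /imsetP[v]; rewrite inE => euv ->.
by apply/imsetP; exists (u, v); rewrite ?inE.
Qed.

End GraphFacts.

Definition swap (T : Type) (p : T * T) := (p.2, p.1).

Definition edge_of (T : finType) (p : T * T) : {set T} := [set p.1; p.2].

Lemma swapK (T : Type) : involutive (@swap T).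
Proof. by case. Qed.

Lemma edge_of_swap (T : finType) (p : T * T) : edge_of (swap p) = edge_of p.
Proof. by rewrite /edge_of setUC. Qed.

Lemma edge_of_inj (T : finType) (p p' : T * T) :
  edge_of p = edge_of p' -> p = p' \/ p = swap p'.
Proof.
case: p p' => [u v] [u' v']; rewrite /edge_of /swap /= => E.
have : u \in [set u'; v'] by rewrite -E set21.
have : v \in [set u'; v'] by rewrite -E set22.
have : u' \in [set u; v] by rewrite E set21.
have : v' \in [set u; v] by rewrite E set22.
rewrite !inE.
by do 4![case/orP=> /eqP ?]; subst; by [left|right].
Qed.

(* [zigzag q 1, ..., zigzag q q] is 1, q, 2, q-1, ...; the values at [0] and at
   [q.+1] are the weights of the fictitious darts in [sum_walk_weight]. *)
Definition zigzag q j := if odd j then j.+1./2 else q.+1 - j./2.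

Lemma zigzag_sum q j : j <= q ->
  zigzag q j + zigzag q j.+1 = if odd j then q.+1 else q.+2.
Proof. rewrite /zigzag /=; have := odd_double_half j; case: (odd j) => /=; lia. Qed.

Lemma zigzagS q j :
  zigzag q j.+1 = if odd j then q - j./2 else (j./2).+1.
Proof. by rewrite /zigzag /= uphalf_half; case: (odd j); rewrite /= ?subSS. Qed.

Lemma zigzag_range q j : odd q -> j < q -> 1 <= zigzag q j.+1 <= q.
Proof.
by rewrite zigzagS; have := odd_double_half j; case: (odd j) => /=; lia.
Qed.

Lemma zigzag_inj q i j : odd q -> i < q -> j < q ->
  zigzag q i.+1 = zigzag q j.+1 -> i = j.
Proof.
rewrite !zigzagS; have := odd_double_half i; have := odd_double_half j.
have := odd_double_half q.
by case: (odd i); case: (odd j); case: (odd q) => //=; lia.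
Qed.

Lemma zigzag_surj q k : odd q -> 1 <= k <= q ->
  exists2 j, j < q & zigzag q j.+1 = k.
Proof.
move=> oq lek; have := odd_double_half q; rewrite oq => Eq.
(* For odd [q] the labels up to [(q+1)/2] sit at the even positions [2(k-1)], the larger ones at the
   odd positions [2(q-k)+1], counting from 0. *)
case: (leqP k q./2.+1) => [le2|lt2].
  exists k.-1.*2; first lia.
  by rewrite zigzagS odd_double doubleK; lia.
exists (q - k).*2.+1; first lia.
by rewrite zigzagS /= odd_double uphalf_double /=; lia.
Qed.

(** In a bipartite graph the parity of the position determines the side. This fixes which of the two
    consecutive sums occurs at a vertex, and the ends of the walk give the parity of its length. *)
Lemma walk_side (D : finType) (V : eqType) (rev : D -> D) (src : D -> V)
    (side : V -> bool) x y c :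
  {in c, forall d, side (tgt rev src d) = ~~ side (src d)} ->
  walk rev src x c y ->
  (forall i, i <= size c ->
     side (nth x (visited rev src x c) i) = side x (+) odd i)
  /\ side y = side x (+) odd (size c).
Proof.
elim: c x => [|d c IH] x /=.
  by move=> _ /eqP<-; rewrite addbF; split=> // -[|i] //=; rewrite addbF.
move=> flip /andP[/eqP Ex W].
have [|nth_side ->] := IH _ _ W.
  by move=> d' d'c; apply: flip; rewrite inE d'c orbT.
have Ed : side (tgt rev src d) = ~~ side x by rewrite flip ?mem_head ?Ex.
split=> [[|i] /=|]; rewrite ?addbF ?addbN ?Ed ?addNb //.
rewrite ltnS => lei; rewrite -addNb -Ed -nth_side //; congr side.
by apply: set_nth_default; rewrite /= size_map ltnS.
Qed.

(** * The graph with [w] split in two, and its labeling *)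

Section Tripartite.
Variables (T : finType) (e : rel T) (w : T) (V2 V3 : {set T}).
Variables (a b m n : nat).
Hypothesis e_sym : symmetric e.
Hypothesis e_irr : irreflexive e.
Hypothesis e_conn : connected_graph e.
Hypothesis V_cover : [set w] :|: V2 :|: V3 = [set: T].
Hypothesis wV2 : w \notin V2.
Hypothesis wV3 : w \notin V3.
Hypothesis V23_disj : [disjoint V2 & V3].
Hypothesis V2_indep : independent e V2.
Hypothesis V3_indep : independent e V3.
Hypothesis w_V2 : #|neighbors e w :&: V2| = 2 * a + 1.
Hypothesis w_V3 : #|neighbors e w :&: V3| = 2 * b + 1.
Hypothesis deg_V2 : {in V2, forall u, degree e u = 2 * m}.
Hypothesis deg_V3 : {in V3, forall v, degree e v = 2 * n}.

Lemma tripartite_cases u : [\/ u = w, u \in V2 | u \in V3].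
Proof.
have : u \in [set w] :|: V2 :|: V3 by rewrite V_cover inE.
by rewrite !inE -orbA => /or3P[/eqP|?|?]; [constructor 1|constructor 2|constructor 3].
Qed.

Lemma V2_notin_V3 u : u \in V2 -> u \in V3 = false.
Proof. by move=> uV2; apply: (disjointFr V23_disj). Qed.

(* The vertex [w] is split into [(w, true)], which keeps the edges to [V3], and
   [(w, false)], which keeps the edges to [V2]; the resulting graph is bipartite
   with the boolean as the colour. *)
Definition split_src (p : T * T) := (p.1, (p.1 \in V2) || (p.2 \in V3)).

Definition darts : {set T * T} := [set p | e p.1 p.2].

Notation split_tgt := (tgt (@swap T) split_src).

Lemma split_side : {in darts, forall p, (split_tgt p).2 = ~~ (split_src p).2}.
Proof.
case=> u v; rewrite inE /= => euv.
have Hu := @V2_notin_V3 u; have Hv := @V2_notin_V3 v.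
have H2 : ~~ ((u \in V2) && (v \in V2)).
  by apply/andP=> -[u2 v2]; have := V2_indep u2 v2; rewrite euv.
have H3 : ~~ ((u \in V3) && (v \in V3)).
  by apply/andP=> -[u3 v3]; have := V3_indep u3 v3; rewrite euv.
have Hn : [|| u \in V2, u \in V3, v \in V2 | v \in V3].
  case: (tripartite_cases u) => [Eu|->|->]; rewrite ?orbT //.
  case: (tripartite_cases v) => [Ev|->|->]; rewrite ?orbT //.
  by rewrite Eu Ev e_irr in euv.
move: Hu Hv H2 H3 Hn.
case: (u \in V2); case: (u \in V3); case: (v \in V2); case: (v \in V3) => //=.
all: by move=> Hu Hv; rewrite ?Hu ?Hv.
Qed.

Lemma split_degreeE u c :
  dart_degree split_src darts (u, c)
  = #|[set v in neighbors e u | ((u \in V2) || (v \in V3)) == c]|.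
Proof.
rewrite -[RHS](@card_imset _ _ (fun v => (u, v))); last by move=> v v' [].
apply: eq_card => -[u' v]; rewrite !inE xpair_eqE /=.
apply/and3P/imsetP => [[euv /eqP Eu cE]|[v']].
  by exists v; rewrite -?Eu // !inE euv cE.
by rewrite !inE => /andP[euv cE] [-> ->].
Qed.

(** Only [w] has two genuine copies; any other vertex keeps all its edges at one copy, and its other
    copy is isolated. *)
Lemma split_degree u c :
  dart_degree split_src darts (u, c)
  = if u == w then (if c then 2 * b + 1 else 2 * a + 1)
    else if u \in V2 then (if c then 2 * m else 0)
    else (if c then 0 else 2 * n).
Proof.
rewrite split_degreeE.
case: (tripartite_cases u) => [->|uV2|uV3].
- rewrite eqxx (negbTE wV2) /=; case: c.
    by rewrite -w_V3; apply: eq_card => v; rewrite !inE eqb_id.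
  rewrite -w_V2; apply: eq_card => v; rewrite !inE eqbF_neg.
  case: (tripartite_cases v) => [->|vV2|vV3]; first by rewrite e_irr.
    by rewrite vV2 V2_notin_V3.
  have := @V2_notin_V3 v; rewrite vV3; case: (v \in V2) => // H.
  by have := H isT.
- rewrite uV2 /=; have /negbTE-> : u != w by apply: contraNneq wV2 => <-.
  case: c; first by rewrite -(deg_V2 uV2); apply: eq_card => v; rewrite !inE andbT.
  by apply: eq_card0 => v; rewrite !inE andbF.
have /negbTE-> : u != w by apply: contraNneq wV3 => <-.
have -> : u \in V2 = false by apply: contraTF uV3 => /V2_notin_V3->.
have nV3 v : e u v -> v \in V3 = false.
  by move=> euv; apply: contraTF euv => /(V3_indep uV3).
case: c.
  by apply: eq_card0 => v; rewrite !inE /=; case E: (e u v); rewrite // nV3.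
rewrite -(deg_V3 uV3); apply: eq_card => v; rewrite !inE /=.
by case E: (e u v); rewrite // nV3.
Qed.

Lemma mem_swap_darts : {in darts, forall p, swap p \in darts}.
Proof. by move=> p; rewrite !inE /= e_sym. Qed.

Lemma swap_neq_darts : {in darts, forall p, swap p != p}.
Proof.
case=> u v; rewrite inE /= => euv; rewrite /swap xpair_eqE /=.
by apply: contraTN euv => /andP[/eqP-> _]; rewrite e_irr.
Qed.

Lemma odd_split_degree z :
  odd (dart_degree split_src darts z) = (z == (w, false)) (+) (z == (w, true)).
Proof.
case: z => u c; rewrite split_degree !xpair_eqE !mul2n.
by case: (u == w); case: c; case: (u \in V2);
  rewrite ?oddD ?odd_double.
Qed.

(** Follow a path of the original graph from [w]. Past a vertex other than [w] all departing darts
    have the same split source, so [A] spreads; at [w] both copies lie in [A] from the start, so the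
    splitting does no harm. *)
Lemma split_connected (A : {set T * T}) :
  A \subset darts ->
  {in A, forall p, swap p \in A} ->
  {in A & darts, forall p p', split_src p = split_src p' -> p' \in A} ->
  {in darts, forall p,
     (split_src p == (w, false)) || (split_src p == (w, true)) -> p \in A} ->
  A = darts.
Proof.
move=> sAF Arev Asrc Aw.
have Aw' v : e w v -> (w, v) \in A.
  move=> ewv; apply: Aw; rewrite ?inE // /split_src !xpair_eqE /= eqxx.
  by case: (_ \in V2); case: (_ \in V3).
suff Aall u : forall v, e u v -> (u, v) \in A.
  by apply/eqP; rewrite eqEsubset sAF; apply/subsetP=> -[u v]; rewrite inE => /Aall.
case/connectP: (e_conn w u) => p; elim/last_ind: p u => [|p u' IH] u /=.
  by move=> _ ->.
rewrite rcons_path last_rcons => /andP[pp el] -> v euv.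
case: (eqVneq u' w) => [Eu|neu]; first by rewrite Eu in euv *; apply: Aw'.
have Au := Arev _ (IH _ pp (erefl _) _ el).
apply: (Asrc _ _ Au); rewrite ?inE // /split_src /=; congr pair.
case: (tripartite_cases u') => [Eu|->//|uV3]; first by rewrite Eu eqxx in neu.
have nV3 v' : e u' v' -> v' \in V3 = false.
  by move=> euv'; apply: contraTF euv' => /(V3_indep uV3).
by rewrite !nV3 // e_sym.
Qed.

(** Glues the two copies of [u] back together: the vertex sum at [u] is the total weight at both
    copies. *)
Lemma mem_edge_of u p : p \in darts ->
  (u \in edge_of p : nat)
  = ((split_src p == (u, true)) + (split_tgt p == (u, true)))
    + ((split_src p == (u, false)) + (split_tgt p == (u, false))).
Proof.
case: p => v v'; rewrite inE /= => evv'.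
rewrite /edge_of /tgt /split_src /= !inE !xpair_eqE !(eq_sym u).
have : ~~ ((v == u) && (v' == u)).
  by apply: contraTN evv' => /andP[/eqP-> /eqP->]; rewrite e_irr.
case: (v == u); case: (v' == u) => //= _.
  by case: (_ || _).
by case: (_ || _).
Qed.

(** At [w] the first label 1 and the last label [(q+1)/2] stay unpaired; the remaining labels there
    form [a] pairs of sum [q+2] and [b] pairs of sum [q+1]. *)
Lemma tripartite_labeling : exists f,
  [/\ edge_labeling e f, odd #|edges e|,
      {in V2, forall u, vertex_sum e f u = m * #|edges e|.+1},
      {in V3, forall u, vertex_sum e f u = n * #|edges e|.+2}
    & vertex_sum e f w
      = a * #|edges e|.+2 + b * #|edges e|.+1 + #|edges e|.+1./2 + 1].
Proof.
have [c [W U cF]] := Euler_trail (@swapK T) mem_swap_darts swap_neq_darts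
  odd_split_degree split_connected.
pose q := size c; pose es := map (@edge_of T) c.
have c_darts : {subset c <= darts}.
  by move=> p pc; rewrite -cF mem_cat pc.
have [Uc /hasPn swap_c _] : [/\ uniq c, ~~ has [in c] (map (@swap T) c)
    & uniq (map (@swap T) c)] by apply/and3P; rewrite -cat_uniq.
have Ues : uniq es.
  rewrite map_inj_in_uniq // => p p' pc p'c /edge_of_inj[//|Ep].
  by have /swap_c := map_f (@swap T) p'c; rewrite -Ep /= pc.
have esE : es =i edges e.
  move=> d; apply/mapP/imsetP => [[p pc ->]|[p]].
    by exists p => //; have := c_darts _ pc; rewrite !inE.
  rewrite inE => ep ->; have : p \in darts by rewrite inE.
  rewrite -cF mem_traversed; last exact: swapK.
  by case/orP=> pc; [exists p|exists (swap p)] => //; rewrite edge_of_swap.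
have Eq : #|edges e| = q.
  by rewrite -(eq_card esE) (card_uniqP Ues) size_map.
(* The trail runs from side [false] to side [true], so its length [q] is odd. *)
have [sides] := walk_side (side := snd)
  (fun p pc => split_side (c_darts p pc)) W.
rewrite /= -/q => oq; rewrite Eq -oq.
have es_q d : d \in edges e -> index d es < q.
  by rewrite -esE -index_mem size_map.
pose f d := zigzag q (index d es).+1.
pose weight z := \sum_(i < q) zigzag q i.+1 *
  ((split_src (nth (w, w) c i) == z) + (split_tgt (nth (w, w) c i) == z)).
have sumE u : vertex_sum e f u = weight (u, true) + weight (u, false).
  rewrite /vertex_sum big_mkcondr -(eq_bigl _ _ esE) -big_uniq //=.
  rewrite (big_nth set0) size_map -/q.
  rewrite big_mkord -big_split /=; apply: eq_bigr => i _.
  rewrite (nth_map (w, w)) // -mulnDr -mem_edge_of; last first.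
    by apply: c_darts; rewrite mem_nth.
  rewrite /f -(nth_map _ set0) // index_uniq ?size_map //.
  by case: (_ \in _); rewrite ?muln1 ?muln0.
(* The terms [q+1] and [(q+1)/2] are the fictitious weights [zigzag q 0] and [zigzag q q.+1] at the
   two ends. Doubling replaces the number of visits to [z] by its degree. *)
have weightE z : (weight z + ((w, false) == z) * q.+1
    + ((w, true) == z) * q.+1./2).*2
  = (if z.2 then q.+1 else q.+2) *
    (dart_degree split_src darts z + ((w, false) == z) + ((w, true) == z)).
  rewrite -(count_dart_degree _ _ U cF) -(count_visited z W).
  rewrite -doubleMr; congr double.
  rewrite -(sum_walk_weight (w, w) (h := zigzag q) W); last first.
    move=> i lei Ei; rewrite zigzag_sum // -Ei sides //=.
  have -> : zigzag q 0 = q.+1 by rewrite /zigzag subn0.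
  suff -> : zigzag q (size c).+1 = q.+1./2 by [].
  by rewrite zigzagS -/q -oq /= uphalf_half -[in LHS](odd_double_half q) -oq; lia.
exists f; split=> //.
- split=> [d /es_q|d d' dE d'E|k lek].
  + by rewrite Eq; apply: zigzag_range.
  + move/zigzag_inj => /(_ _ (es_q _ dE) (es_q _ d'E)) Ei.
    by rewrite -(nth_index set0 (s := es) (x := d)) ?esE // Ei // nth_index ?esE.
  + rewrite Eq in lek; have [j ltj <-] := zigzag_surj (esym oq) lek.
    exists (nth set0 es j); first by rewrite -esE mem_nth ?size_map.
    by rewrite /f index_uniq ?size_map.
- move=> u uV2; rewrite sumE.
  have new : u == w = false by apply: contraNF wV2 => /eqP<-.
  have := weightE (u, true); have := weightE (u, false).
  by rewrite !split_degree new uV2 !xpair_eqE !(eq_sym w) new /=; clear; lia.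
- move=> u uV3; rewrite sumE.
  have new : u == w = false by apply: contraNF wV3 => /eqP<-.
  have uV2 : u \in V2 = false by apply: contraTF uV3 => /V2_notin_V3->.
  have := weightE (u, true); have := weightE (u, false).
  by rewrite !split_degree new uV2 !xpair_eqE !(eq_sym w) new /=; clear; lia.
rewrite sumE; have := weightE (w, true); have := weightE (w, false).
have := odd_uphalfK (esym oq : odd q).
by rewrite !split_degree !xpair_eqE !eqxx /=; clear; lia.
Qed.

End Tripartite.

(** * Size estimates separating the three sums *)

(** Equality would force [n < m], hence [(n+1)(q+1) <= n(q+2)], that is [q+1 <= n]. *)
Lemma vertex_sum_V2_neq_V3 q m n :
  0 < m -> 2 * n <= q -> m * q.+1 != n * q.+2.
Proof.
move=> m0 lenq; apply/eqP => E.
have ltnm : n < m by rewrite -(ltn_pmul2r (ltn0Sn q)) E; nia.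
have : n.+1 * q.+1 <= m * q.+1 by rewrite leq_mul2r.
nia.
Qed.

(** Modulo [q+1] the right side is [a + (q+1)/2 + 1], which lies strictly between 0 and [q+1]. *)
Lemma vertex_sum_V2_neq_w q a b m :
  odd q -> 2 * a + 2 * b + 2 <= q ->
  m * q.+1 != a * q.+2 + b * q.+1 + q.+1./2 + 1.
Proof.
move=> oq leq; apply/eqP => E; set h := q.+1./2 in E.
have Eq : q.+1 = 2 * h by have := odd_double_half q.+1; rewrite /= oq; lia.
have E' : (m - (a + b)) * q.+1 = a + h + 1 by rewrite mulnBl mulnDl; lia.
case: (m - (a + b)) E' => [|[|k]]; rewrite ?mulSn; lia.
Qed.

(** Modulo [q+2] the right side is [(q+1)/2 + 1 - b], which lies strictly between 0 and [q+2]. *)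
Lemma vertex_sum_V3_neq_w q a b n :
  odd q -> 2 * a + 2 * b + 2 <= q ->
  n * q.+2 != a * q.+2 + b * q.+1 + q.+1./2 + 1.
Proof.
move=> oq leq; apply/eqP => E; set h := q.+1./2 in E.
have Eq : q.+1 = 2 * h by have := odd_double_half q.+1; rewrite /= oq; lia.
have E' : (n - (a + b)) * q.+2 = h + 1 - b by rewrite mulnBl mulnDl; lia.
case: (n - (a + b)) E' => [|k]; rewrite ?mulSn; lia.
Qed.

(** * The local antimagic chromatic number *)

Theorem theorem2p12 (T : finType) (e : rel T)
    (e_sym : symmetric e) (e_irr : irreflexive e)
    (e_conn : connected_graph e)
    (chi3 : is_chromatic_number e 3)
    (w : T) (V2 V3 : {set T}) (x y a b m n : nat)
    (V_cover : [set w] :|: V2 :|: V3 = [set: T])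
    (V12_disj : [disjoint [set w] & V2])
    (V13_disj : [disjoint [set w] & V3])
    (V23_disj : [disjoint V2 & V3])
    (V1_indep : independent e [set w])
    (V2_indep : independent e V2)
    (V3_indep : independent e V3)
    (card_V2 : #|V2| = x) (x_ge2 : 2 <= x)
    (card_V3 : #|V3| = y) (y_ge2 : 2 <= y)
    (w_V2 : #|neighbors e w :&: V2| = 2 * a + 1)
    (w_V3 : #|neighbors e w :&: V3| = 2 * b + 1)
    (m_gt0 : 0 < m) (n_gt0 : 0 < n)
    (deg_V2 : {in V2, forall u, degree e u = 2 * m})
    (deg_V3 : {in V3, forall v, degree e v = 2 * n}) :
  is_local_antimagic_chromatic_number e 3.
Proof.
split=> [|k [f f_la <-]]; last first.
  by case: chi3 => _; apply; apply: num_vertex_sums_colorable.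
have wV2 : w \notin V2 by rewrite -disjoints1.
have wV3 : w \notin V3 by rewrite -disjoints1.
have [f [f_lab odd_q f2 f3 fw]] := tripartite_labeling e_sym e_irr e_conn V_cover
  wV2 wV3 V23_disj V2_indep V3_indep w_V2 w_V3 deg_V2 deg_V3.
have [u2 u2V] : exists u, u \in V2 by apply/card_gt0P; rewrite card_V2; lia.
have [u3 u3V] : exists u, u \in V3 by apply/card_gt0P; rewrite card_V3; lia.
(* Counting the edges at [w], and below those at one vertex of [V3], gives the lower bounds on [q]
   for the size estimates. *)
have le_w : 2 * a + 2 * b + 2 <= #|edges e|.
  apply: leq_trans (degree_le_edges e_irr w).
  have : #|neighbors e w :&: V2 :|: neighbors e w :&: V3| <= degree e w.
    by apply: subset_leq_card; rewrite -setIUr subsetIl.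
  rewrite cardsU w_V2 w_V3 (_ : _ :&: _ :&: _ = set0) ?cards0; first lia.
  apply/setP=> v; rewrite !inE.
  by case v2: (v \in V2); rewrite ?andbF // (disjointFr V23_disj v2) !andbF.
have le3 : 2 * n <= #|edges e| by rewrite -(deg_V3 _ u3V) degree_le_edges.
have n23 := vertex_sum_V2_neq_V3 m_gt0 le3.
have n2w := vertex_sum_V2_neq_w m odd_q le_w.
have n3w := vertex_sum_V3_neq_w n odd_q le_w.
exists f.
  split=> // u v euv; apply/eqP.
  case: (tripartite_cases V_cover u) (tripartite_cases V_cover v)
    => [Eu|u2'|u3'] [Ev|v2|v3].
  - by rewrite Eu Ev e_irr in euv.
  - by rewrite Eu fw f2 // eq_sym.
  - by rewrite Eu fw f3 // eq_sym.
  - by rewrite Ev fw f2.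
  - by have := V2_indep _ _ u2' v2; rewrite euv.
  - by rewrite f2 ?f3.
  - by rewrite Ev fw f3.
  - by rewrite f3 ?f2 // eq_sym.
  - by have := V3_indep _ _ u3' v3; rewrite euv.
pose s3 := [:: vertex_sum e f u2; vertex_sum e f u3; vertex_sum e f w].
rewrite /num_vertex_sums (perm_size (_ : perm_eq _ s3)) //.
apply: uniq_perm; rewrite ?undup_uniq //.
  by rewrite /= !inE f2 // f3 // fw negb_or n23 n2w n3w.
move=> k; rewrite mem_undup; apply/mapP/idP => [[u _ ->]|].
  rewrite /s3 !inE; case: (tripartite_cases V_cover u) => [->|uV|uV].
  - by rewrite eqxx !orbT.
  - by rewrite (f2 _ uV) (f2 _ u2V) eqxx.
  - by rewrite (f3 _ uV) (f3 _ u3V) eqxx orbT.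
rewrite /s3 !inE => /or3P[] /eqP->.
- by exists u2; rewrite ?mem_enum.
- by exists u3; rewrite ?mem_enum.
- by exists w; rewrite ?mem_enum.
Qed.
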